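(* Let $n>1$ and $d>1$ be integers and let $K$ be an algebraically closed field. Fix a diagonal term order on $K[a_{i,j}]_{1\le i\le n,\,0\le j\le d}$, and let $G$ be the set of minors corresponding to reduced minor walks. Then $G$ is a Gröbner basis of the resultant ideal $I_{d,n}$ with respect to this term order.
   Context: The $a_{i,j}$ ($1\le i\le n$, $0\le j\le d$) are independent indeterminates over $K$, and $f_i(x)=a_{i,0}x^d+a_{i,1}x^{d-1}+\cdots+a_{i,d}$ for $1\le i\le n$. The resultant ideal is $I_{d,n}=\langle f_1,\dots,f_n\rangle\cap K[a_{i,j}]$, where $\langle f_1,\dots,f_n\rangle\subset K[a_{i,j}][x]$. For $1\le k\le d$, $M_k$ is the $nk\times(d+k)$ matrix whose rows are indexed by pairs $(i,j)$, $1\le i\le k$, $1\le j\le n$, ordered lexicographically from top to bottom, whose columns are indexed by $1,\dots,d+k$, and whose entry in row $(i,j)$ and column $c$ is $a_{j,c-i}$ if $0\le c-i\le d$ and $0$ otherwise. A diagonal term order is a term order such that, for every $1\le k\le d$, the leading monomial of every not identically zero minor of $M_k$ is the product of the diagonal entries of the corresponding square submatrix (rows and columns kept in their order in $M_k$). Such term orders exist; one is fixed. Minor walks: let $k\ge1$. A minor walk of length $d+k$ is a sequence $(u_1,v_1),\dots,(u_{d+k},v_{d+k})$ of points of the lattice $\{1,\dots,n\}\times\{0,\dots,d\}$ such that (1) for each $1\le s<d+k$, either $v_{s+1}\le v_s$, or both $v_{s+1}=v_s+1$ and $u_{s+1}>u_s$; (2) $v_1=0$ and $v_{d+k}=d$.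 A minor walk is reduced if it is minimal under inclusion, i.e. no vertex (term of the sequence) can be deleted so that the remaining sequence is still a minor walk. Reduced minor walks have length at most $2d$. A $(d+k)\times(d+k)$ minor of $M_k$ is given by a choice of $d+k$ rows, listed in lexicographic order as $((i_1,j_1),\dots,(i_{d+k},j_{d+k}))$. The nonzero such minors are in bijection with minor walks of length $d+k$ via $(u_s,v_s)=(j_s,s-i_s)$. $G$ is the set of $(d+k)\times(d+k)$ minors of $M_k$, $1\le k\le d$, that correspond under this bijection to reduced minor walks. *)

(* Defs.v *)
From HB Require Import structures.
From mathcomp Require Import all_boot all_order all_algebra.
From mathcomp Require Import mpoly mxtens.
Set Implicit Arguments.
Unset Strict Implicit.
Unset Printing Implicit Defensive.
Import GRing.Theory.
Local Open Scope ring_scope.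

(* The ideal generated by a (possibly infinite) set S. *)
Definition ideal_gen (R : comNzRingType) (S : R -> Prop) : R -> Prop :=
  fun p => exists (m : nat) (c g : 'I_m -> R),
    (forall i, S (g i)) /\ p = \sum_(i < m) c i * g i.

(* Monomials 'X_{1..N} are written additively: 0 is the monomial 1 and
   (a + b)%MM is the product of a and b. *)
Definition term_order (N : nat) (le : rel 'X_{1..N}) : Prop :=
  [/\ reflexive le, antisymmetric le, transitive le & total le]
  /\ (forall a, le 0%MM a)
  /\ (forall a b c, le a b -> le (a + c)%MM (b + c)%MM).

(* No monomial is the leading monomial of 0, whose support is empty. *)
Definition is_lead_monomial (K : fieldType) (N : nat) (le : rel 'X_{1..N})
    (p : {mpoly K[N]}) (a : 'X_{1..N}) : Prop :=
  a \in msupp p /\ forall b, b \in msupp p -> le b a.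

Definition initial_ideal (K : fieldType) (N : nat) (le : rel 'X_{1..N})
    (S : {mpoly K[N]} -> Prop) : {mpoly K[N]} -> Prop :=
  ideal_gen (fun q => exists p a,
    [/\ S p, is_lead_monomial le p a & q = 'X_[a]]).

Definition groebner_basis (K : fieldType) (N : nat) (le : rel 'X_{1..N})
    (I G : {mpoly K[N]} -> Prop) : Prop :=
  [/\ exists s : seq {mpoly K[N]}, forall p, G p <-> p \in s,
      forall p, G p -> I p
    & forall p, initial_ideal le I p <-> initial_ideal le G p].

(* The indeterminate a_{i,j}.  The row index i, like the index i of M_k below,
   is shifted to start at 0; j ranges over 0, ..., d unshifted. *)
Definition coef_var (K : fieldType) (n d : nat) (i : 'I_n) (j : 'I_d.+1) :
    {mpoly K[n * d.+1]} :=
  'X_(mxtens_index (i, j)).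

Definition generic_poly (K : fieldType) (n d : nat) (i : 'I_n) :
    {poly {mpoly K[n * d.+1]}} :=
  \sum_(j < d.+1) coef_var K i j *: 'X^(d - j).

Definition resultant_ideal (K : fieldType) (n d : nat) :
    {mpoly K[n * d.+1]} -> Prop :=
  fun p => ideal_gen (fun f => exists i : 'I_n, f = generic_poly K d i) p%:P.

(* Row r of M_k carries the pair mxtens_unindex r = (r %/ n, r %% n), so that
   the order on 'I_(k * n) is the lexicographic order on pairs (i, j).  Since
   i and c are both shifted by one, the difference c - i is unchanged. *)
Definition coef_mx (K : fieldType) (n d k : nat) :
    'M[{mpoly K[n * d.+1]}]_(k * n, d + k) :=
  \matrix_(r, c)
    let i := (mxtens_unindex r).1 in
    let j := (mxtens_unindex r).2 in
    if (i <= c <= i + d)%N then coef_var K j (inord (c - i)) else 0.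

Definition increasing_ord (m p : nat) (f : 'I_m -> 'I_p) : Prop :=
  forall s t : 'I_m, (s < t)%N -> (f s < f t)%N.

Definition diagonal_term_order (K : fieldType) (n d : nat)
    (le : rel 'X_{1..n * d.+1}) : Prop :=
  term_order le /\
  forall k m (f : 'I_m -> 'I_(k * n)) (g : 'I_m -> 'I_(d + k)),
    (1 <= k <= d)%N -> increasing_ord f -> increasing_ord g ->
    \det (mxsub f g (coef_mx K n d k)) != 0 ->
    exists2 a, is_lead_monomial le (\det (mxsub f g (coef_mx K n d k))) a
             & \prod_(s < m) coef_mx K n d k (f s) (g s) = 'X_[a].

Definition walk_step (n d : nat) (p q : 'I_n * 'I_d.+1) : bool :=
  (q.2 <= p.2)%N || (q.2 == p.2.+1 :> nat) && (p.1 < q.1)%N.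

(* The length is d + k with k >= 1, so w is nonempty and the default values
   of head and last play no role. *)
Definition minor_walk (n d : nat) (w : seq ('I_n * 'I_d.+1)) : bool :=
  [&& (d < size w)%N, sorted (@walk_step n d) w,
      head ord_max (unzip2 w) == ord0 & last ord0 (unzip2 w) == ord_max].

Definition reduced_minor_walk (n d : nat) (w : seq ('I_n * 'I_d.+1)) : Prop :=
  minor_walk w /\
  forall s, (s < size w)%N -> ~~ minor_walk (take s w ++ drop s.+1 w).

(* The rows f of a maximal minor of M_k correspond to the walk w given by
   (u_s, v_s) = (j_s, s - i_s), i.e. i_s + v_s = s: no truncation occurs. *)
Definition rows_of_walk (n d k : nat) (f : 'I_(d + k) -> 'I_(k * n))
    (w : (d + k).-tuple ('I_n * 'I_d.+1)) : Prop :=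
  forall s : 'I_(d + k),
    (tnth w s).1 = (mxtens_unindex (f s)).2 /\
    ((mxtens_unindex (f s)).1 + (tnth w s).2)%N = s.

Definition reduced_walk_minor (K : fieldType) (n d : nat) :
    {mpoly K[n * d.+1]} -> Prop :=
  fun p => exists (k : nat) (f : 'I_(d + k) -> 'I_(k * n))
                  (w : (d + k).-tuple ('I_n * 'I_d.+1)),
    [/\ (1 <= k <= d)%N, increasing_ord f, reduced_minor_walk w,
        rows_of_walk f w & p = \det (rowsub f (coef_mx K n d k))].

(* Main.v *)
(** Call level [v] the points [(u, v)].  A set of variables contains the support
    of a minor walk iff for every [v < d] it contains some [a_{u,v}] and
    [a_{u',v+1}] with [u < u']: inside a level a walk moves freely.  So it
    suffices that the leading monomial [m] of every [p] in the resultant ideal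
    involves such a pair for each [v].

    If it does not, there is an index [t] such that [m] involves no [a_{u,v}]
    with [u < t] and no [a_{u,v+1}] with [u > t].  Put
    [theta = a_{t,v+1} / a_{t,v}] and solve [f_u(theta) = 0] for [a_{u,v}] when
    [u <= t] and for [a_{u,v+1}] when [u > t].  The 2x2 minors of the [M_k] show
    that, for a diagonal term order, the leading monomial of the solution is at
    most the variable it replaces, with equality for [u = t].  Substituting
    these solutions in [p] gives 0 since the [f_u] acquire the common root
    [theta], yet the coefficient of [m] in the result is nonzero, as [m] avoids
    all the variables whose leading monomial may drop. *)

From HB Require Import structures.
Require Import Defs.
From mathcomp Require Import all_boot all_order all_fingroup all_algebra.
From mathcomp Require Import mpoly mxtens fraction zify ring.
Set Implicit Arguments.
Unset Strict Implicit.
Unset Printing Implicit Defensive.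
Import GRing.Theory.
Local Open Scope ring_scope.

(** * Term orders and bounds for leading terms *)

Section TermOrder.

Variables (N : nat) (le : rel 'X_{1..N}).
Hypothesis le_term_order : term_order le.

Definition term_lt : rel 'X_{1..N} := fun a b => (a != b) && le a b.

Lemma term_le_refl a : le a a.
Proof. by case: le_term_order => -[+ _ _ _] _; apply. Qed.

Lemma term_le_trans : transitive le.
Proof. by case: le_term_order => -[]. Qed.

Lemma term_le_anti : antisymmetric le.
Proof. by case: le_term_order => -[]. Qed.

Lemma term_leD2r c a b : le (a + c)%MM (b + c)%MM = le a b.
Proof.
case: le_term_order => -[_ anti _ tot] [_ leD].
apply/idP/idP=> [leac|/leD]; last exact.
case/orP: (tot a b) => // leba.
suff -> : a = b by exact: term_le_refl.
by apply: (@addIm _ c); apply: anti; rewrite leac leD.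
Qed.

Lemma term_ltD2r c a b : term_lt (a + c)%MM (b + c)%MM = term_lt a b.
Proof. by rewrite /term_lt term_leD2r eqm_add2r. Qed.

Lemma term_ltD2l c a b : term_lt (c + a)%MM (c + b)%MM = term_lt a b.
Proof. by rewrite ![(c + _)%MM]addmC term_ltD2r. Qed.

Lemma term_lt_trans : transitive term_lt.
Proof.
move=> b a c /andP[nab leab] /andP[nbc lebc].
rewrite /term_lt (term_le_trans leab lebc) andbT.
apply: contra_neq nab => eac; apply: term_le_anti.
by rewrite leab eac.
Qed.

Lemma term_ltD a b a' b' :
  term_lt a b -> term_lt a' b' -> term_lt (a + a')%MM (b + b')%MM.
Proof.
by move=> ab a'b'; apply: (@term_lt_trans (b + a')%MM);
  rewrite ?term_ltD2r ?term_ltD2l.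
Qed.

Section Leading.

Variable K : fieldType.
Implicit Types (p q : {mpoly K[N]}) (b : 'X_{1..N}) (c : K).

Definition all_below b q := {in msupp q, forall a, term_lt a b}.

(* Keeping the coefficient [c], possibly 0, in the predicate makes it stable
   under sums, products and enlarging [b]. *)
Definition lead_term b c q := all_below b (q - c *: 'X_[b]).

Lemma all_belowD b p q : all_below b p -> all_below b q -> all_below b (p + q).
Proof.
move=> bp bq a /msuppD_le; rewrite mem_cat => /orP[]; [exact: bp|exact: bq].
Qed.

Lemma all_belowZ b c q : all_below b q -> all_below b (c *: q).
Proof. by move=> bq a /msuppZ_le; apply: bq. Qed.

Lemma all_belowX a b : term_lt a b -> all_below b 'X_[a].
Proof. by move=> ab m; rewrite msuppX inE => /eqP->. Qed.

Lemma all_belowM b b' p q : all_below b p -> all_below b' q ->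
  all_below (b + b')%MM (p * q).
Proof.
move=> bp bq m /msuppM_le /allpairsP[[x y] /= [xp yq ->]].
by apply: term_ltD; [exact: bp|exact: bq].
Qed.

Lemma all_belowXM a b q : all_below b q -> all_below (a + b)%MM ('X_[a] * q).
Proof.
move=> bq m /msuppM_le /allpairsP[[x y] /= []].
by rewrite msuppX inE => /eqP-> yq ->; rewrite term_ltD2l bq.
Qed.

Lemma lead_term_below b q : all_below b q -> lead_term b 0 q.
Proof. by rewrite /lead_term scale0r subr0. Qed.

Lemma lead_termX b : lead_term b 1 'X_[b].
Proof. by rewrite /lead_term scale1r subrr => a; rewrite msupp0. Qed.

Lemma lead_termD b c c' p q : lead_term b c p -> lead_term b c' q ->
  lead_term b (c + c') (p + q).
Proof.
rewrite /lead_term scalerDl opprD addrACA; exact: all_belowD.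
Qed.

Lemma lead_termZ b c c' q : lead_term b c q -> lead_term b (c' * c) (c' *: q).
Proof.
by rewrite /lead_term -scalerA -scalerBr => /(@all_belowZ _ c').
Qed.

Lemma lead_term_sum (I : Type) (r : seq I) (P : pred I) b
    (c : I -> K) (F : I -> {mpoly K[N]}) :
  (forall i, P i -> lead_term b (c i) (F i)) ->
  lead_term b (\sum_(i <- r | P i) c i) (\sum_(i <- r | P i) F i).
Proof.
move=> lF; elim/big_rec2: _ => [|i x y Pi].
  by apply: lead_term_below => a; rewrite msupp0.
by apply: lead_termD; exact: lF.
Qed.

Lemma lead_termM b b' c c' p q : lead_term b c p -> lead_term b' c' q ->
  lead_term (b + b')%MM (c * c') (p * q).
Proof.
rewrite /lead_term.
move Ep: (p - _) => p'; move Eq: (q - _) => q' bp bq.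
move/(canRL (subrK _)): Ep => ->; move/(canRL (subrK _)): Eq => ->.
rewrite mpolyXD mulrDl !mulrDr -!scalerAl -!scalerAr scalerA.
rewrite [p' * 'X_[_]]mulrC !addrA addrK.
apply: all_belowD; first apply: all_belowD.
- exact: all_belowM.
- by rewrite addmC; apply: all_belowZ; exact: all_belowXM.
- by apply: all_belowZ; exact: all_belowXM.
Qed.

Lemma lead_termXn b c q k : lead_term b c q ->
  lead_term (b *+ k)%MM (c ^+ k) (q ^+ k).
Proof.
move=> lq; elim: k => [|k IHk].
  by rewrite !expr0 mulm0n -mpolyX0; exact: lead_termX.
by rewrite mulmS !exprS; exact: lead_termM.
Qed.

Lemma lead_term_prod (I : Type) (r : seq I) (P : pred I)
    (b : I -> 'X_{1..N}) (c : I -> K) (F : I -> {mpoly K[N]}) :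
  (forall i, P i -> lead_term (b i) (c i) (F i)) ->
  lead_term (\sum_(i <- r | P i) b i)%MM (\prod_(i <- r | P i) c i)
    (\prod_(i <- r | P i) F i).
Proof.
move=> lF.
elim/big_rec3: _ => [|i x y z Pi]; last by apply: lead_termM; exact: lF.
by rewrite -mpolyX0; exact: lead_termX.
Qed.

Lemma lead_term_lt a b c q : term_lt a b -> lead_term a c q -> lead_term b 0 q.
Proof.
move=> ab lq; apply: lead_term_below; rewrite -(subrK (c *: 'X_[a]) q).
apply: all_belowD; last by apply: all_belowZ; exact: all_belowX.
by move=> m /lq /term_lt_trans; apply.
Qed.

(** Used to show that a polynomial is not 0: a nonzero coefficient at the bound rules this out. *)
Lemma lead_term0 b c : lead_term b c 0 -> c = 0.
Proof.
move=> l0; apply/eqP; apply: contraT => c0.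
have /l0 : b \in msupp (0 - c *: 'X_[b]).
  by rewrite sub0r (perm_mem (msuppN _)) msuppMCX // inE.
by rewrite /term_lt eqxx.
Qed.

End Leading.

End TermOrder.

(** * Inequalities between variables from 2x2 minors *)

Lemma det_mx22 (R : comNzRingType) (A : 'M[R]_2) :
  \det A = A ord0 ord0 * A ord_max ord_max - A ord0 ord_max * A ord_max ord0.
Proof.
rewrite (expand_det_row A ord0) !big_ord_recl big_ord0 addr0 /cofactor !det_mx11.
rewrite !mxE /= expr0 expr1 mul1r mulN1r mulrN.
by congr (_ * A _ _ - A _ _ * A _ _); apply: val_inj.
Qed.

Section MinorExchange.

Variables (K : fieldType) (n d : nat).

(** The second index is a natural number so that shifts such as [v.+1] can be written; [inord] is
    faithful for [q <= d] only. *)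
Definition var_idx (u : 'I_n) (q : nat) : 'I_(n * d.+1) :=
  mxtens_index (u, inord q).

Lemma eq_var_idx u u' q q' : (q <= d)%N -> (q' <= d)%N ->
  (var_idx u q == var_idx u' q') = (u == u') && (q == q').
Proof.
move=> qd q'd; rewrite (can_eq (@mxtens_indexK _ _)) xpair_eqE.
by rewrite -(inj_eq val_inj (inord q)) /= !inordK.
Qed.

Lemma coef_mxE k (i : 'I_k) (j : 'I_n) (c : 'I_(d + k)) q :
  (q <= d)%N -> c = (i + q)%N :> nat ->
  coef_mx K n d k (mxtens_index (i, j)) c = 'X_(var_idx j q).
Proof.
move=> qd cE; rewrite mxE mxtens_indexK /= cE leq_addr leq_add2l qd /=.
by rewrite addKn.
Qed.

Variable le : rel 'X_{1..n * d.+1}.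
Hypothesis hle : diagonal_term_order K le.

(** The minor is a binomial with two distinct monomials, hence nonzero, and a diagonal order puts
    its diagonal monomial on top. *)
Lemma minor2_term_lt k (r r' : 'I_(k * n)) (c c' : 'I_(d + k)) a b a' b' :
  (1 <= k <= d)%N -> (r < r')%N -> (c < c')%N ->
  coef_mx K n d k r c = 'X_[a] -> coef_mx K n d k r' c' = 'X_[b] ->
  coef_mx K n d k r c' = 'X_[a'] -> coef_mx K n d k r' c = 'X_[b'] ->
  (a' + b' != a + b)%MM -> term_lt le (a' + b')%MM (a + b)%MM.
Proof.
move=> hk rr' cc' Ea Eb Ea' Eb' neq.
pose f (s : 'I_2) := if s == ord0 then r else r'.
pose g (s : 'I_2) := if s == ord0 then c else c'.
have hf : increasing_ord f by move=> [[|[|s]] ?] [[|[|t]] ?].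
have hg : increasing_ord g by move=> [[|[|s]] ?] [[|[|t]] ?].
have detE : \det (mxsub f g (coef_mx K n d k)) = 'X_[a + b] - 'X_[a' + b'].
  by rewrite det_mx22 ![mxsub _ _ _ _ _]mxE /f /g /= Ea Eb Ea' Eb' !mpolyXD.
have supp m : m \in msupp ('X_[a + b] - 'X_[a' + b'] : {mpoly K[n * d.+1]}) =
    ((m == a + b) || (m == a' + b'))%MM.
  rewrite mcoeff_msupp mcoeffB !mcoeffX.
  have [<-|n1] := eqVneq (a + b)%MM m.
    by rewrite (negPf neq) subr0 oner_eq0.
  have [_|n2] := eqVneq (a' + b')%MM m.
    by rewrite orbT sub0r oppr_eq0 oner_eq0.
  by rewrite subrr eqxx.
case: hle => _ /(_ k 2 f g hk hf hg); rewrite detE => -[].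
  by apply/eqP => E; have := supp (a + b)%MM; rewrite E msupp0 eqxx.
move=> m [_ mle]; rewrite !big_ord_recl big_ord0 mulr1 /f /g /= Ea Eb -mpolyXD.
move/(congr1 (fun p => m \in msupp p)); rewrite !msuppX !inE eqxx => /eqP mE.
by rewrite /term_lt neq -mE mle // supp eqxx orbT.
Qed.

(** Take columns [r] and [r.+1] of [M_k] with [k = r - p + 1], row [t] of the first block and row
    [u] of the last one. As the blocks differ, [t] and [u] may come in any order. *)
Lemma concavity_term_lt (t u : 'I_n) p r : (p < r < d)%N ->
  term_lt le (U_(var_idx t r.+1) + U_(var_idx u p))%MM
             (U_(var_idx t r) + U_(var_idx u p.+1))%MM.
Proof.
case/andP=> pr rd; pose k := (r - p).+1.
have kd : (k <= d)%N by rewrite (leq_ltn_trans (leq_subr _ _)).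
have c1 : (r < d + k)%N by rewrite ltn_addr.
have c2 : (r.+1 < d + k)%N by rewrite /k addnS ltnS ltn_addr.
apply: (@minor2_term_lt k (mxtens_index (ord0, t)) (mxtens_index (ord_max, u))
  (Ordinal c1) (Ordinal c2)) => //.
- by rewrite /= mul0n add0n ltn_addr // (leq_trans (ltn_ord t)) // leq_pmull
    // subn_gt0.
- by apply: coef_mxE => //; rewrite ltnW.
- by apply: coef_mxE; [exact: ltn_trans rd | rewrite /= addnS subnK // ltnW].
- by apply: coef_mxE.
- apply: coef_mxE; last by rewrite /= subnK // ltnW.
  by rewrite ltnW // (ltn_trans pr).
apply/eqP => /(congr1 (fun m : 'X_{1.._} => m (var_idx t r))) /eqP.
have pd : (p < d)%N by exact: ltn_trans rd.
rewrite !mnmDE !mnm1E !eq_var_idx ?eqxx ?(ltnW pd) ?(ltnW rd) //.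
by rewrite (ltn_eqF pr) (gtn_eqF (ltnSn r)) !andbF.
Qed.

(** Both rows lie in the single block of [M_1], whence the condition [u < t]. *)
Lemma row_term_lt (u t : 'I_n) v : (u < t)%N -> (v < d)%N ->
  term_lt le (U_(var_idx u v.+1) + U_(var_idx t v))%MM
             (U_(var_idx u v) + U_(var_idx t v.+1))%MM.
Proof.
move=> ut vd.
have c1 : (v < d + 1)%N by rewrite addn1 ltnW.
have c2 : (v.+1 < d + 1)%N by rewrite addn1.
have d1 : (1 <= d)%N by exact: leq_ltn_trans vd.
apply: (@minor2_term_lt 1 (mxtens_index (ord0, u)) (mxtens_index (ord0, t))
  (Ordinal c1) (Ordinal c2)) => //.
- by apply: coef_mxE => //; rewrite ltnW.
- by apply: coef_mxE.
- by apply: coef_mxE.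
- by apply: coef_mxE => //; rewrite ltnW.
apply/eqP => /(congr1 (fun m : 'X_{1.._} => m (var_idx u v))) /eqP.
rewrite !mnmDE !mnm1E !eq_var_idx ?eqxx //; try exact: ltnW.
by rewrite -(inj_eq val_inj t u) (gtn_eqF ut) (gtn_eqF (ltnSn v)).
Qed.

End MinorExchange.

(** * Evaluation at points with coordinates in a fraction field *)

Lemma mnm_mulmDr (N : nat) (m : 'X_{1..N}) i j :
  (m *+ (i + j) = m *+ i + m *+ j)%MM.
Proof. by apply/mnmP => x; rewrite mnmDE !mulmnE mulnDr. Qed.

Section RationalPoint.

Variables (N : nat) (le : rel 'X_{1..N}) (K : fieldType).
Hypothesis le_term_order : term_order le.

Definition fracC : K -> {fraction {mpoly K[N]}} := @tofrac _ \o @mpolyC N K.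

HB.instance Definition _ := GRing.RMorphism.on fracC.

(** Let [e] bound the degree of [p]. Multiplication by ['X_[D] ^+ e] turns the term of a monomial
    [b] into a polynomial bounded by [b + D *+ e]. The shift is the same for all [b], so only the
    term of [m] can reach [m + D *+ e], and its coefficient there is a product of nonzero
    scalars. *)
Lemma mmap_frac_neq0 (A : 'I_N -> {mpoly K[N]}) (c : 'I_N -> K)
    (D : 'X_{1..N}) p m :
    (forall x, lead_term le (U_(x) + D)%MM (c x) (A x)) ->
    is_lead_monomial le p m -> (forall x, m x != 0%N -> c x != 0) ->
  mmap fracC (fun x => tofrac (A x) / tofrac 'X_[D]) p != 0.
Proof.
move=> leadA [mp mlead] cm.
set h := fun x => _; pose e := msize p.
have XD0 : tofrac ('X_[D] : {mpoly K[N]}) != 0.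
  by rewrite tofrac_eq0; apply/eqP => /(congr1 (fun p => D \in msupp p));
     rewrite msuppX msupp0 inE eqxx.
(* The spare power of ['X_[D]] puts terms of different degrees over one denominator. *)
pose num (b : 'X_{1..N}) : {mpoly K[N]} :=
  p@_b *: ((\prod_x A x ^+ b x) * 'X_[D] ^+ (e - mdeg b)).
have numE : tofrac ('X_[D] : {mpoly K[N]}) ^+ e * mmap fracC h p =
    tofrac (\sum_(b <- msupp p) num b).
  rewrite /mmap mulr_sumr rmorph_sum /= !big_seq; apply: eq_bigr => b bp.
  have be : (mdeg b <= e)%N by rewrite ltnW // msize_mdeg_lt.
  rewrite /num -mul_mpolyC !rmorphM /= mulrCA; congr (_ * _).
  rewrite -{1}(subnK be) exprD rmorphXn -mulrA mulrC; congr (_ * _).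
  rewrite mdegE -prodrXr rmorph_prod -big_split; apply: eq_bigr => x _ /=.
  by rewrite rmorphXn -exprMn mulrC divfK.
have lead_num b : b \in msupp p ->
    lead_term le (b + D *+ e)%MM (p@_b * \prod_x c x ^+ b x) (num b).
  move=> bp; have be : (mdeg b <= e)%N by rewrite ltnW // msize_mdeg_lt.
  have -> : (b + D *+ e =
      \sum_x (U_(x) + D) *+ b x + D *+ (e - mdeg b))%MM.
    apply/mnmP => y; rewrite !mnmDE mnm_sumE !mulmnE.
    under eq_bigr do rewrite mulmnE mnmDE mulnDl.
    rewrite big_split -big_distrr /= -mdegE.
    rewrite (bigD1 y) //= mnm1E eqxx mul1n big1 ?addn0.
      by rewrite -addnA -mulnDr subnKC.
    by move=> x xy; rewrite mnm1E (negPf xy).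
  apply: lead_termZ.
  rewrite (_ : \prod_x c x ^+ b x =
    (\prod_x c x ^+ b x) * 1 ^+ (e - mdeg b)); last by rewrite expr1n mulr1.
  apply: lead_termM => //; last by apply: lead_termXn => //; exact: lead_termX.
  by apply: lead_term_prod => // x _; exact: lead_termXn.
apply/eqP => map0; move/eqP: numE; rewrite map0 mulr0 eq_sym tofrac_eq0.
rewrite (big_rem m) //= => /eqP sum0.
pose s := p@_m * \prod_x c x ^+ m x.
have : lead_term le (m + D *+ e)%MM s 0.
  rewrite -sum0 -[s]addr0; apply: lead_termD; first exact: lead_num.
  rewrite big_seq.
  rewrite [X in lead_term _ _ X](_ : _ =
    \sum_(b <- rem m (msupp p) | b \in rem m (msupp p)) 0); last by rewrite big1.
  apply: lead_term_sum => // b; rewrite mem_rem_uniq ?msupp_uniq // inE.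
  case/andP=> bm bp; apply: (lead_term_lt _ _ (lead_num _ bp)) => //.
  by rewrite term_ltD2r // /term_lt bm mlead.
move/lead_term0/eqP; apply/negP; rewrite mulf_neq0 -?mcoeff_msupp //.
apply/prodf_neq0 => x _; case: (m x) (cm x) => [_|k /(_ isT) /expf_neq0 //].
by rewrite expr0 oner_eq0.
Qed.

End RationalPoint.

(** Evaluating the coefficients at [a] and [x] at [theta] is a ring morphism that kills every [f_u],
    hence their ideal; on a constant polynomial in [x] it agrees with the evaluation at [a]. *)
Lemma resultant_ideal_eval0 (K : fieldType) (n d : nat) (S : comNzRingType)
    (f : {rmorphism K -> S}) (a : 'I_(n * d.+1) -> S) (theta : S) p :
    (forall u : 'I_n,
      \sum_(j < d.+1) a (mxtens_index (u, j)) * theta ^+ (d - j) = 0) ->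
  resultant_ideal p -> mmap f a p = 0.
Proof.
move=> root0 [m [c [g [gE pE]]]].
pose ev q := (map_poly (mmap f a) q).[theta].
have <- : ev p%:P = mmap f a p by rewrite /ev map_polyC hornerC.
rewrite pE /ev rmorph_sum horner_sum big1 // => i _.
have [u ->] := gE i; rewrite rmorphM hornerM /generic_poly rmorph_sum horner_sum.
rewrite [X in _ * X](_ : _ = 0) ?mulr0 // -[RHS](root0 u); apply: eq_bigr => j _.
by rewrite /= map_polyZ map_polyXn hornerZ hornerXn /= mmapX mmap1U.
Qed.

(** With [theta = z / y] this is [theta^(d-j) = theta^(p-j) theta^(d-p)] multiplied by [y^d z^d],
    which makes all exponents natural numbers. *)
Lemma shift_ratio (F : fieldType) (y z : F) d p j :
    y != 0 -> (p <= d)%N -> (j <= d)%N ->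
  y ^+ d * z ^+ d * (z ^+ (d - j) / y ^+ (d - j)) =
  y ^+ (d + j - p) * z ^+ (d + p - j) * (z ^+ (d - p) / y ^+ (d - p)).
Proof.
move=> y0 pd jd; rewrite !mulrA; apply/eqP; rewrite eqr_div ?expf_neq0 //.
have regroup a b a' b' :
    y ^+ a * z ^+ b * z ^+ b' * y ^+ a' = y ^+ (a + a') * z ^+ (b + b').
  by rewrite !exprD; ring.
by apply/eqP; rewrite !regroup; congr (_ ^+ _ * _ ^+ _); lia.
Qed.

(** * A point where all [f_u] have a common root *)

Section CommonRoot.

Variables (K : fieldType) (n d : nat) (le : rel 'X_{1..n * d.+1}).
Hypothesis hle : diagonal_term_order K le.
Variables (t : 'I_n) (v : nat).
Hypothesis vd : (v < d)%N.

Let le_term_order : term_order le := proj1 hle.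

Local Notation U u q := (U_(var_idx d u q))%MM.
Local Notation y := (U t v).
Local Notation z := (U t v.+1).

(** The equation [f_u(theta) = 0] is solved for [a_{u, pivot u}]. This is the index where
    [a_{u,q} theta^(d-q)] is largest, with a tie at [v.+1] when [u = t]. *)
Definition pivot (u : 'I_n) := if (u <= t)%N then v else v.+1.

Lemma pivot_le u : (pivot u <= d)%N.
Proof. by rewrite /pivot; case: ifP => // _; exact: ltnW. Qed.

(** In terms of [theta] this reads [a_{u,q} theta < a_{u,q+1}]. Concavity gives it for [q < v]; the
    case [q = v] arises only for [t < u] and comes from [M_1]. *)
Lemma below_pivot_step u q : (q < pivot u)%N ->
  term_lt le (U u q + z)%MM (U u q.+1 + y)%MM.
Proof.
have conc : (q < v)%N -> term_lt le (U u q + z)%MM (U u q.+1 + y)%MM.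
  move=> qv; rewrite addmC [(U u _ + _)%MM]addmC.
  by apply: (concavity_term_lt hle); rewrite qv vd.
rewrite /pivot; case: (leqP u t) => [_ //|tu]; rewrite ltnS leq_eqVlt => /predU1P[->|//].
by rewrite addmC [(U u _ + _)%MM]addmC; exact: (row_term_lt hle).
Qed.

(** The pair [(t, v)] is excluded because both sides are then equal, by the choice of [theta]. *)
Lemma above_pivot_step u q : (pivot u <= q < d)%N -> (u, q) != (t, v) ->
  term_lt le (U u q.+1 + y)%MM (U u q + z)%MM.
Proof.
case/andP=> puq qd; rewrite xpair_eqE.
have conc : (v < q)%N -> term_lt le (U u q.+1 + y)%MM (U u q + z)%MM.
  by move=> vq; apply: (concavity_term_lt hle); rewrite vq qd.
move: puq; rewrite /pivot; case: (leqP u t) => [ut|_ vq _]; last exact: conc.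
rewrite leq_eqVlt => /predU1P[<-|/conc //]; rewrite eqxx andbT => neq_ut.
by apply: (row_term_lt hle); rewrite // ltn_neqAle neq_ut.
Qed.

Lemma below_pivot u i : (0 < i <= pivot u)%N ->
  term_lt le (U u (pivot u - i) + z *+ i)%MM (U u (pivot u) + y *+ i)%MM.
Proof.
elim: i => [|[|i] IHi] // /andP[_ ip].
  rewrite !mulm1n; have := @below_pivot_step u (pivot u - 1).
  by rewrite subn1 prednK // => /(_ (leqnn _)).
apply: (term_lt_trans le_term_order
  (y := (U u (pivot u - i.+1) + y + z *+ i.+1)%MM)).
  rewrite [(z *+ i.+2)%MM]mulmS addmA term_ltD2r //.
  have := @below_pivot_step u (pivot u - i.+2).
  by rewrite subnSK // => /(_ (leq_subr _ _)).
rewrite -addmA [(y + _)%MM]addmC addmA [(y *+ i.+2)%MM]mulmSr addmA.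
by rewrite term_ltD2r // IHi //= ltnW.
Qed.

(** The start [b] is left free because for [u = t] the chain of steps has to begin at [v.+1], past
    the equality. *)
Lemma above_pivot_from u b i : (pivot u <= b)%N -> (u, b) != (t, v) ->
  (0 < i)%N -> (b + i <= d)%N ->
  term_lt le (U u (b + i) + y *+ i)%MM (U u b + z *+ i)%MM.
Proof.
move=> pb ub; elim: i => [|[|i] IHi] // _ bi.
  by rewrite !mulm1n addn1; apply: above_pivot_step; rewrite // pb -addn1.
apply: (term_lt_trans le_term_order
  (y := (U u (b + i.+1) + z + y *+ i.+1)%MM)).
  rewrite [(y *+ i.+2)%MM]mulmS addmA term_ltD2r // addnS.
  apply: above_pivot_step; first by rewrite (leq_trans pb) ?leq_addr // -addnS.
  move: ub pb; rewrite !xpair_eqE /pivot; have [->|//] := eqVneq u t.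
  rewrite leqnn /= => _ vb; apply/negbT/gtn_eqF.
  by rewrite addnS ltnS (leq_trans vb) // leq_addr.
rewrite -addmA [(z + _)%MM]addmC addmA [(z *+ i.+2)%MM]mulmSr addmA.
by rewrite term_ltD2r // IHi // ltnW // -addnS.
Qed.

Lemma above_pivot u i : (0 < i)%N -> (pivot u + i <= d)%N ->
    (u, pivot u + i)%N != (t, v.+1) ->
  term_lt le (U u (pivot u + i) + y *+ i)%MM (U u (pivot u) + z *+ i)%MM.
Proof.
move=> i0; have [->|ut] := eqVneq u t; last first.
  by move=> ud _; apply: above_pivot_from; rewrite // xpair_eqE (negPf ut).
rewrite /pivot leqnn xpair_eqE eqxx; case: i i0 => [|[|i]] // _ ud.
  by rewrite addn1 eqxx.
move=> _; rewrite [(y *+ _)%MM]mulmS [(z *+ _)%MM]mulmS.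
rewrite addmA [(_ + y)%MM]addmC -addmA term_ltD2l //.
rewrite -addSnnS; apply: above_pivot_from => //.
- by rewrite /pivot leqnn.
- by rewrite xpair_eqE (gtn_eqF (ltnSn v)) andbF.
by rewrite addSnnS.
Qed.

(* The exponent of [X_{u,q} theta^(pivot u - q)], where [theta = z / y], times
   the denominator [y^d z^d]. *)
Definition pivot_exponent (u : 'I_n) q : 'X_{1..n * d.+1} :=
  (U u q + (y *+ (d + q - pivot u) + z *+ (d + pivot u - q)))%MM.

Definition root_denom := (y *+ d + z *+ d)%MM.

(** This is [below_pivot] or [above_pivot] multiplied by a monomial in [y] and [z], with [i] the
    distance from [q] to the pivot. *)
Lemma pivot_exponent_lt u q : (q <= d)%N -> q != pivot u ->
    (u, q) != (t, v.+1) ->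
  term_lt le (pivot_exponent u q) (U u (pivot u) + root_denom)%MM.
Proof.
move=> qd qp uq; rewrite /pivot_exponent /root_denom.
have pd := pivot_le u.
case: (ltngtP q (pivot u)) qp => // qp _.
  pose i := (pivot u - q)%N.
  have := @below_pivot u i; rewrite leq_subr subn_gt0 qp => /(_ isT).
  rewrite (_ : (pivot u - i)%N = q); last by rewrite subKn // ltnW.
  rewrite -(term_ltD2r le_term_order (y *+ (d - i) + z *+ d)%MM).
  rewrite (_ : (d + q - pivot u)%N = (d - i)%N); last by lia.
  rewrite (_ : (d + pivot u - q)%N = (d + i)%N); last by lia.
  rewrite (_ : (y *+ d)%MM = (y *+ (d - i) + y *+ i)%MM); last first.
    by rewrite -mnm_mulmDr subnK //; lia.
  rewrite (mnm_mulmDr z); congr (term_lt le _ _); apply/mnmP => x;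
    by rewrite !mnmDE; lia.
pose i := (q - pivot u)%N; have qE : q = (pivot u + i)%N by rewrite subnKC // ltnW.
have := @above_pivot u i; rewrite -qE subn_gt0 qp => /(_ isT qd uq).
rewrite -(term_ltD2r le_term_order (y *+ d + z *+ (d - i))%MM).
rewrite (_ : (d + q - pivot u)%N = (d + i)%N); last by lia.
rewrite (_ : (d + pivot u - q)%N = (d - i)%N); last by lia.
rewrite (_ : (z *+ d)%MM = (z *+ (d - i) + z *+ i)%MM); last first.
  by rewrite -mnm_mulmDr subnK //; lia.
rewrite (mnm_mulmDr y); congr (term_lt le _ _); apply/mnmP => x;
  by rewrite !mnmDE; lia.
Qed.

(** The tie for [u = t]: thanks to this term the solution for [a_{t,v}] keeps the leading monomial
    [a_{t,v}], with coefficient -1. *)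
Lemma pivot_exponent_root :
  pivot_exponent t v.+1 = (U t v + root_denom)%MM.
Proof.
rewrite /pivot_exponent /root_denom /pivot leqnn.
rewrite (_ : (d + v.+1 - v)%N = d.+1); last by lia.
have -> : (z *+ d)%MM = (z *+ (d + v - v.+1) + z)%MM.
  by rewrite -mulmSr; congr (_ *+ _)%MM; lia.
by rewrite mulmS; apply/mnmP => x; rewrite !mnmDE; lia.
Qed.

(** Numerators of the coordinates over the common denominator ['X_[root_denom]]; variables that are
    not pivots keep their value. *)
Definition root_numer (x : 'I_(n * d.+1)) : {mpoly K[n * d.+1]} :=
  let u := (mxtens_unindex x).1 in
  if (mxtens_unindex x).2 == pivot u :> nat
  then - \sum_(j < d.+1 | j != pivot u :> nat) 'X_[pivot_exponent u j]
  else 'X_[U_(x) + root_denom].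

(** It vanishes exactly at the pivots of the [u] other than [t], where the leading monomial
    drops. *)
Definition root_coef (x : 'I_(n * d.+1)) : K :=
  let u := (mxtens_unindex x).1 in
  if (mxtens_unindex x).2 == pivot u :> nat then - (u == t)%:R else 1.

Lemma root_numer_lead x :
  lead_term le (U_(x) + root_denom)%MM (root_coef x) (root_numer x).
Proof.
case: (mxtens_indexP x) => u q; rewrite /root_coef /root_numer mxtens_indexK /=.
case: eqP => [qE|_]; last exact: lead_termX.
rewrite -[X in - X]mulr1 -scaleN1r -mulN1r; apply: lead_termZ; rewrite mulr1.
have -> : mxtens_index (u, q) = var_idx d u (pivot u).
  by rewrite /var_idx -qE inord_val.
have below (j : 'I_d.+1) : j != pivot u :> nat -> (u, j : nat) != (t, v.+1) ->
    lead_term le (U u (pivot u) + root_denom)%MM 0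
      ('X_[pivot_exponent u j] : {mpoly K[n * d.+1]}).
  move=> jp uj; apply/lead_term_below/all_belowX/pivot_exponent_lt => //.
  by rewrite -ltnS.
have sum_below (P : pred 'I_d.+1) : (forall j, P j ->
      j != pivot u :> nat /\ (u, j : nat) != (t, v.+1)) ->
    lead_term le (U u (pivot u) + root_denom)%MM 0
      (\sum_(j | P j) 'X_[pivot_exponent u j] : {mpoly K[n * d.+1]}).
  move=> hP; rewrite [X in lead_term _ _ X](_ : _ = \sum_(j | P j) 0).
    by apply: lead_term_sum => // j /hP[]; exact: below.
  by rewrite big1.
have [ut|ut] := eqVneq u t; last first.
  by apply: sum_below => j jp; rewrite xpair_eqE (negPf ut).
have vd1 : (v.+1 < d.+1)%N by [].
rewrite (bigD1 (inord v.+1)) /= inordK //; last first.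
  by rewrite /pivot ut leqnn gtn_eqF.
rewrite -[X in lead_term _ _ X]addr0; apply: lead_termD.
  rewrite ut pivot_exponent_root /pivot leqnn; exact: lead_termX.
apply: sum_below => j /andP[-> jv]; split=> //; rewrite xpair_eqE ut eqxx /=.
by rewrite -(inj_eq val_inj) /= inordK in jv.
Qed.

(** The summand of the pivot cancels the others term by term, by [shift_ratio] at [p = pivot u]. *)
Lemma root_numer_root (u : 'I_n) :
  \sum_(j < d.+1) tofrac (root_numer (mxtens_index (u, j))) / tofrac 'X_[root_denom]
    * (tofrac 'X_[z] / tofrac 'X_[y]) ^+ (d - j) = 0.
Proof.
have X0 m : tofrac ('X_[m] : {mpoly K[n * d.+1]}) != 0.
  by rewrite tofrac_eq0; apply/eqP => /(congr1 (fun p => m \in msupp p));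
     rewrite msuppX msupp0 inE eqxx.
have pd : (pivot u < d.+1)%N by rewrite ltnS pivot_le.
rewrite (bigD1 (inord (pivot u))) //= {1}/root_numer mxtens_indexK /= inordK //.
rewrite eqxx rmorphN rmorph_sum !mulNr addrC; apply/eqP; rewrite subr_eq0; apply/eqP.
rewrite !mulr_suml; apply: eq_big => [j|j jp].
  by rewrite -(inj_eq val_inj) /= inordK.
have {}jp : j != pivot u :> nat.
  by apply: contra jp => /eqP jp; rewrite -jp inord_val.
rewrite /root_numer mxtens_indexK /= (negPf jp).
rewrite ![_ / _ * _]mulrAC; congr (_ / _).
have -> : mxtens_index (u, j) = var_idx d u j by rewrite /var_idx inord_val.
rewrite /pivot_exponent /root_denom.
rewrite !mpolyXD -!mpolyXn !rmorphM /= !rmorphXn /= !exprMn !exprVn.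
rewrite -[RHS]mulrA -[LHS]mulrA; congr (_ * _); apply: shift_ratio.
- exact: X0.
- by rewrite -ltnS.
- by rewrite -ltnS.
Qed.

Lemma resultant_ideal_lead (p : {mpoly K[n * d.+1]}) m :
    resultant_ideal p -> is_lead_monomial le p m ->
    (forall u : 'I_n, (u < t)%N -> m (var_idx d u v) = 0%N) ->
    (forall u : 'I_n, (t < u)%N -> m (var_idx d u v.+1) = 0%N) ->
  False.
Proof.
move=> Ip lead_p lt0 gt0.
(* A variable with coefficient 0 is the pivot of some [u] other than [t], and [lt0] and [gt0] keep
   it out of [m]. *)
have coef_neq0 x : m x != 0%N -> root_coef x != 0.
  rewrite /root_coef; case: (_ =P pivot _) => [xE|_ _]; last by rewrite oner_neq0.
  rewrite oppr_eq0; have [_|ut] := eqVneq _ t; first by rewrite oner_neq0.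
  apply: contraNneq => _; apply/eqP.
  rewrite -[x]mxtens_unindexK; set u := (mxtens_unindex x).1 in xE ut *.
  rewrite [mxtens_unindex x]surjective_pairing -/u -[(mxtens_unindex x).2]inord_val.
  rewrite xE -/(var_idx d u _) /pivot.
  case: (ltngtP u t) => [/lt0->|/gt0->|/val_inj E] //.
  by rewrite E eqxx in ut.
have := mmap_frac_neq0 le_term_order root_numer_lead lead_p coef_neq0.
by rewrite (resultant_ideal_eval0 _ root_numer_root Ip) eqxx.
Qed.

End CommonRoot.

(** * Nonvanishing of maximal minors *)

(** The strict rearrangement inequality, by induction on the number of moved points. If [i] is the
    least moved point and [s j = i], then [i < j] and [i < s i]; exchanging the values at [i] and
    [j] fixes [i] and raises the sum by [(s i - i) * (r j - r i)]. *)
Lemma sum_mul_perm_lt (m : nat) (r : 'I_m -> nat) (s : 'S_m) :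
    (forall i j : 'I_m, (i < j)%N -> (r i < r j)%N) -> s != 1%g ->
  (\sum_(i < m) s i * r i < \sum_(i < m) i * r i)%N.
Proof.
move=> mono_r.
have [c] := ubnP #|[set i | s i != i]|; elim: c s => // c IHc s leSc s1.
have [i0 i0s] : exists i, s i != i.
  apply/existsP; apply: contraR s1 => /existsPn fix_s.
  by apply/eqP/permP => i; rewrite perm1; apply/eqP; have := fix_s i; rewrite negbK.
case: (@arg_minnP _ i0 (fun i => s i != i) val i0s) => i si imin.
have fix_lt (j : 'I_m) : (j < i)%N -> s j = j.
  by move=> ji; apply: contraTeq ji => /imin; rewrite -leqNgt.
have i_lt_s : (i < s i)%N.
  rewrite ltn_neqAle eq_sym -(inj_eq val_inj) in si *; rewrite si /= leqNgt.
  by apply: contra si => /fix_lt /perm_inj ->.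
pose j := (s^-1)%g i; have sj : s j = i by rewrite /j permKV.
have ij : (i < j)%N.
  rewrite ltnNge leq_eqVlt negb_or; apply/andP; split.
    apply: contra si => /eqP/val_inj ji; rewrite -{1}ji sj //.
  by apply/negP => ji; have := fix_lt _ ji; rewrite sj => E; rewrite -E ltnn in ji.
pose s' := (tperm i j * s)%g.
have s'i : s' i = i by rewrite permM tpermL.
have s'j : s' j = s i by rewrite permM tpermR.
have s'D k : k != i -> k != j -> s' k = s k.
  by move=> ki kj; rewrite permM tpermD // eq_sym.
have lt_s' : (\sum_k s k * r k < \sum_k s' k * r k)%N.
  have ji : j != i by rewrite -(inj_eq val_inj) gtn_eqF.
  have split2 (F : 'I_m -> nat) :
      (\sum_k F k = F i + F j + \sum_(k | (k != i) && (k != j)) F k)%N.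
    by rewrite (bigD1 i) //= (bigD1 j) //= addnA.
  rewrite !split2 s'i s'j sj.
  rewrite (eq_bigr (fun k => (s' k * r k)%N)); last first.
    by move=> k /andP[ki kj]; rewrite s'D.
  rewrite ltn_add2r; have := mono_r _ _ ij; nia.
have [s'E|s'1] := eqVneq s' 1%g.
  by rewrite s'E in lt_s'; apply: leq_trans lt_s' _; apply: leq_sum => k _; rewrite perm1.
apply: ltn_trans lt_s' _; apply: IHc => //; rewrite -ltnS; apply: leq_trans leSc.
rewrite ltnS; apply: proper_card; apply/properP; split.
  apply/subsetP => k; rewrite !inE; have [->|ki] := eqVneq k i.
    by rewrite s'i eqxx.
  have [->|kj] := eqVneq k j; last by rewrite s'D.
  by rewrite sj -(inj_eq val_inj i) (ltn_eqF ij).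
by exists i; rewrite inE // s'i eqxx.
Qed.

Section MinorNonzero.

Variables (K : fieldType) (n d k : nat) (f : 'I_(d + k) -> 'I_(k * n)).
Hypothesis mono_f : increasing_ord f.

Local Notation row s := (mxtens_unindex (f s)).1.
Local Notation col s := (mxtens_unindex (f s)).2.

(* The squared difference between the column number and [f s / n], up to the
   factor [n^2] and a shift; summed over the entries picked by a permutation it
   depends only on the monomial, and the rearrangement inequality makes the
   identity the only minimizer. *)
Definition band_weight (x : 'I_(n * d.+1)) : nat :=
  (n * (mxtens_unindex x).2.+1 - (mxtens_unindex x).1) ^ 2.

(** Since [f s = row s * n + col s], the number squared in the weight is [n * c.+1 - f s]. The cross
    term stands on the left to avoid truncated subtraction. *)
Lemma band_weightE s (c : nat) : (row s <= c <= row s + d)%N ->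
  (band_weight (var_idx d (col s) (c - row s)) + 2 * (n * (c.+1 * f s)) =
   n ^ 2 * c.+1 ^ 2 + f s ^ 2)%N.
Proof.
case: (mxtens_indexP (f s)) => i0 j0.
rewrite /band_weight /var_idx !mxtens_indexK /= => /andP[rc cr].
rewrite inordK ?ltnS ?leq_subLR //; have := ltn_ord j0.
move: (nat_of_ord i0) (nat_of_ord j0) rc cr => i j rc cr jn.
have [q ->] : exists q, c = (i + q)%N by exists (c - i)%N; lia.
rewrite addKn; have [e ->] : exists e, n = (j + e)%N by exists (n - j)%N; lia.
rewrite (_ : ((j + e) * q.+1 - j)%N = ((j + e) * q + e)%N); last by nia.
by ring.
Qed.

Definition pick_mnm (s : 'S_(d + k)) : 'X_{1..n * d.+1} :=
  (\sum_i U_(var_idx d (col i) (s i - row i)))%MM.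

Lemma pick_mnm_weight (s : 'S_(d + k)) :
  (\sum_x pick_mnm s x * band_weight x =
   \sum_i band_weight (var_idx d (col i) (s i - row i)))%N.
Proof.
under eq_bigr do rewrite mnm_sumE big_distrl /=.
rewrite exchange_big; apply: eq_bigr => i _ /=.
rewrite (bigD1 (var_idx d (col i) (s i - row i))) //= mnm1E eqxx mul1n.
by rewrite big1 ?addn0 // => x; rewrite mnm1E eq_sym => /negPf->.
Qed.

Definition band (s : 'S_(d + k)) := [forall i, row i <= s i <= row i + d]%N.

Lemma pick_mnm_inj (s : 'S_(d + k)) :
  band 1%g -> band s -> s != 1%g -> pick_mnm s != pick_mnm 1%g.
Proof.
move=> /forallP b1 /forallP bs s1; apply/eqP => eq_pick.
have total (t : 'S_(d + k)) : (forall i, row i <= t i <= row i + d)%N ->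
  (\sum_x pick_mnm t x * band_weight x + 2 * (n * \sum_i (t i).+1 * f i) =
   n ^ 2 * \sum_(i < d + k) i.+1 ^ 2 + \sum_i f i ^ 2)%N.
  move=> bt; rewrite pick_mnm_weight !big_distrr /=.
  rewrite [in RHS](reindex_inj (@perm_inj _ t)) -!big_split /=.
  by apply: eq_bigr => i _; exact: band_weightE.
(* Equal monomials have equal weights, so the two totals force equal cross terms, against the
   rearrangement inequality. *)
have := total 1%g b1; rewrite -(total s bs) eq_pick => /addnI.
have n0 : (0 < n)%N.
  rewrite lt0n; apply: contra s1 => /eqP n0; apply/eqP/permP => i; exfalso.
  by have := leq_trans (ltn_ord (col i)) (eq_leq n0).
move/eqP; rewrite !eqn_pmul2l // => /eqP.
have splitS (t : 'S_(d + k)) :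
    (\sum_i (t i).+1 * f i = \sum_i f i + \sum_i t i * f i)%N.
  by rewrite -big_split; apply: eq_bigr => i _; rewrite mulSn.
rewrite !splitS => /addnI.
have := sum_mul_perm_lt mono_f s1.
have -> : (\sum_(i < d + k) i * f i = \sum_i (1%g : 'S_(d + k)) i * f i)%N.
  by apply: eq_bigr => i _; rewrite perm1.
by move=> lt_sum eq_sum; rewrite eq_sum ltnn in lt_sum.
Qed.

Lemma prod_coef_mx (s : 'S_(d + k)) :
  \prod_i coef_mx K n d k (f i) (s i) = if band s then 'X_[pick_mnm s] else 0.
Proof.
case: ifPn => [/forallP bs|/forallPn[i bi]].
  rewrite -mprodXE; apply: eq_bigr => i _.
  rewrite -[f i in LHS]mxtens_unindexK [mxtens_unindex (f i)]surjective_pairing.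
  by case/andP: (bs i) => rc cr; apply: coef_mxE; rewrite ?subnKC // leq_subLR.
rewrite (bigD1 i) //= (_ : coef_mx _ _ _ _ _ _ = 0) ?mul0r //.
by rewrite mxE; exact: ifN.
Qed.

(** In the Leibniz formula the diagonal monomial arises from the identity alone, hence with
    coefficient 1. This allows [diagonal_term_order], which speaks of nonzero minors, to be
    applied. *)
Lemma det_rowsub_neq0 : band 1%g ->
  \det (rowsub f (coef_mx K n d k)) != 0.
Proof.
move=> b1; apply/eqP => /(congr1 (mcoeff (pick_mnm 1%g))) /eqP.
have prodE (s : 'S_(d + k)) :
    \prod_i rowsub f (coef_mx K n d k) i (s i) =
    if band s then 'X_[pick_mnm s] else 0.
  by rewrite -prod_coef_mx; apply: eq_bigr => i _; rewrite [LHS]mxE.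
rewrite mcoeff0 /determinant raddf_sum (bigD1 1%g) //= [X in _ + X]big1 => [|s s1].
  by rewrite odd_perm1 expr0 mul1r addr0 prodE b1 mcoeffX eqxx oner_eq0.
rewrite prodE; case: ifP => [bs|_]; last by rewrite mulr0 mcoeff0.
rewrite -signr_odd mulr_sign; case: ifP => _; rewrite ?mcoeffN mcoeffX;
  by rewrite (negPf (pick_mnm_inj b1 bs s1)) ?oppr0.
Qed.

End MinorNonzero.

(** * Combinatorics of minor walks *)

Section Walks.

Variables (n d : nat).
Local Notation point := ('I_n * 'I_d.+1)%type.
Local Notation step := (@walk_step n d).
Implicit Types (w s : seq point) (a p q : point).

(** A step raises the level by at most one, so a path from level 0 to level [d] has more than [d]
    points. *)
Lemma minor_walk_cons a s : (0 < d)%N ->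
  minor_walk (a :: s) =
  [&& path step a s, a.2 == ord0 & (last a s).2 == ord_max].
Proof.
move=> d0; rewrite /minor_walk /= last_map; apply: andb_idl.
case/and3P=> + /eqP a0 /eqP sd.
have level b r : path step b r -> ((last b r).2 <= b.2 + size r)%N.
  elim: r b => [|c r IHr] b /=; first by rewrite addn0.
  case/andP=> bc /IHr /leq_trans -> //; rewrite addnS -addSn leq_add2r.
  by case/orP: bc => [/leqW|/andP[/eqP->]].
by move/level; rewrite a0 sd.
Qed.

Lemma sorted_walk_level w p i j : sorted step w -> (i <= j < size w)%N ->
  ((nth p w j).2 <= (nth p w i).2 + (j - i))%N.
Proof.
move=> /(sortedP p) stepw /andP[]; elim: j => [|j IHj].
  by rewrite leqn0 => /eqP->; rewrite subnn addn0.
rewrite leq_eqVlt => /predU1P[->|ij] jw; first by rewrite subnn addn0.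
rewrite subSn // addnS; apply: (@leq_trans (nth p w j).2.+1).
  by case/orP: (stepw j jw) => [/leqW|/andP[/eqP->]].
by rewrite ltnS IHj // ltnW.
Qed.

(** When [size w = d + k], the bounds place [i - v_i] between 0 and [k - 1], so that it numbers a
    block of [M_k]. *)
Lemma minor_walk_level w p i : minor_walk w -> (i < size w)%N ->
  ((nth p w i).2 <= i)%N /\ (d <= (nth p w i).2 + (size w - i.+1))%N.
Proof.
case: w => // a s /and4P[_ sw /eqP /= a0 /eqP]; rewrite last_map => sd iw.
have level := sorted_walk_level p sw.
split; first by have := level 0 i iw; rewrite /= a0 subn0.
have := level i (size s); rewrite -ltnS iw /= ltnSn => /(_ isT).
by rewrite -[size s]/(size (a :: s)).-1 nth_last /= sd subSS.
Qed.

Lemma reduced_subwalk w : minor_walk w ->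
  exists2 r, subseq r w & reduced_minor_walk r.
Proof.
have [c] := ubnP (size w); elim: c w => // c IHc w le_w walk_w.
have [/existsP[i walk_i]|/existsPn red] :=
  boolP [exists i : 'I_(size w), minor_walk (take i w ++ drop i.+1 w)].
  have sub : subseq (take i w ++ drop i.+1 w) w.
    rewrite -[X in subseq _ X](cat_take_drop i) subseq_cat2l //.
    by rewrite -[i.+1]add1n -drop_drop; exact: drop_subseq.
  case: (IHc _ _ walk_i) => [|r sub_r]; last by exists r => //; exact: subseq_trans sub.
  rewrite size_cat size_take size_drop ltn_ord; have := ltn_ord i; lia.
exists w => //; split=> // i iw.
exact: red (Ordinal iw).
Qed.

(** From the end of one edge the walk moves within its level to the start of the next, so each level
    contributes at most two points, and levels 0 and [d] one each. *)
Lemma walk_of_edges (A : pred point) : (0 < d)%N ->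
    (forall v, (v < d)%N -> exists u u' : 'I_n,
      [/\ (u < u')%N, A (u, inord v) & A (u', inord v.+1)]) ->
  exists w, [/\ minor_walk w, uniq w, (size w <= d + d)%N & all A w].
Proof.
move=> d0 edge.
(* The last clause makes the end point the only one of level at least [v], which keeps the points of
   the extended walk distinct. *)
suff walk_to v : (0 < v <= d)%N -> exists a s u,
    [/\ path step a s, a.2 = ord0, last a s = (u, inord v) &
      [/\ uniq (a :: s), (size (a :: s) <= v + v)%N, all A (a :: s)
        & {in a :: s, forall p, v <= p.2 -> p = (u, inord v)}]]%N.
  have [|a [s [u [path_s a0 last_s [uniq_s size_s all_s _]]]]] := walk_to d.
    by rewrite d0 leqnn.
  exists (a :: s); split=> //; rewrite minor_walk_cons // path_s a0 last_s eqxx /=.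
  by rewrite -(inj_eq val_inj) /= inordK.
elim: v => [|v IHv] // /andP[_ vd]; have [u [u' [uu' Au Au']]] := edge v vd.
have vE : (inord v : 'I_d.+1) = v :> nat by rewrite inordK // ltnW.
have vSE : (inord v.+1 : 'I_d.+1) = v.+1 :> nat by rewrite inordK.
case: v => [|v] in IHv vd uu' Au Au' vE vSE *.
  exists (u, inord 0), [:: (u', inord 1)], u'; split=> //=.
  - by rewrite andbT /walk_step /= vE vSE uu' orbT.
  - exact: val_inj.
  split=> //; rewrite ?Au ?Au' // ?inE ?xpair_eqE.
    by rewrite -(inj_eq val_inj) (ltn_eqF uu').
  by move=> p; rewrite !inE => /orP[] /eqP -> //=; rewrite vE.
have [|a [s [u0 [path_s a0 last_s [uniq_s size_s all_s top_s]]]]] := IHv.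
  exact: ltnW.
(* If the next edge starts where the walk ends, that point is not repeated. *)
pose t : seq point := if u == u0 then [:: (u', inord v.+2)]
          else [:: (u, inord v.+1); (u', inord v.+2)].
have step_e : step (u, inord v.+1) (u', inord v.+2).
  by rewrite /walk_step /= vE vSE eqxx uu' orbT.
have path_t : path step (last a s) t.
  rewrite last_s /t; case: eqVneq => [<-|_] /=; rewrite step_e // andbT.
  by rewrite /walk_step /= leqnn.
have new_notin : (u', inord v.+2) \notin a :: s.
  apply/negP => /top_s /=; rewrite vSE leqnSn => /(_ isT) [_].
  by move/(congr1 val); rewrite /= vE vSE => /eqP; rewrite (gtn_eqF (ltnSn _)).
have top_t : {in t, forall p, v.+2 <= p.2 -> p = (u', inord v.+2)}%N.
  rewrite /t => p; case: ifP => _; rewrite !inE; first by move/eqP.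
  by case/orP=> /eqP-> //=; rewrite vE ltnn.
exists a, (s ++ t), u'; split=> //.
- by rewrite cat_path path_s.
- by rewrite last_cat /t; case: ifP.
rewrite -cat_cons; split.
- rewrite cat_uniq uniq_s /t; case: eqVneq => [_|uu0]; rewrite /= orbF.
    by rewrite (negPf new_notin).
  rewrite (negPf new_notin) orbF mem_seq1 xpair_eqE.
  rewrite -(inj_eq val_inj (inord v.+1)) /= vE vSE (ltn_eqF (ltnSn _)) !andbF andbT.
  rewrite andbT; apply/negP => /top_s /=; rewrite vE leqnn.
  by move=> /(_ isT) [/eqP]; rewrite (negPf uu0).
- rewrite size_cat /t; case: ifP => _ /=; move: size_s => /=; lia.
- by rewrite all_cat all_s /t; case: ifP => _ /=; rewrite ?Au ?Au'.
move=> p; rewrite mem_cat => /orP[ps vp|]; last exact: top_t.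
have := top_s _ ps (ltnW vp) => pE; move: vp; rewrite pE /= vE ltnn //.
Qed.

End Walks.

(** * Walks and leading monomials *)

Section WalkMinors.

Variables (K : fieldType) (n d : nat) (le : rel 'X_{1..n * d.+1}).
Hypothesis hle : diagonal_term_order K le.

(** The walk has length [d + k.+1], so the matrix is [M_{k+1}]; point [s] gives row [u_s] of block
    [s - v_s]. A step that does not raise the level increases the block, any other keeps the block
    and increases [u], so the rows are increasing. The diagonal entry in column [s] is the variable
    of point [s]. *)
Lemma walk_minor_lead k (w : (d + k.+1).-tuple ('I_n * 'I_d.+1)) :
    (k < d)%N -> reduced_minor_walk w ->
  exists2 p, @reduced_walk_minor K n d p &
    is_lead_monomial le p (\sum_(x <- w) U_(mxtens_index x))%MM.
Proof.
move=> kd red_w; have [walk_w _] := red_w.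
have [p0] : exists p0 : 'I_n * 'I_d.+1, True.
  by case: (tval w) walk_w => // p0 *; exists p0.
move=> _; pose v i := (nth p0 w i).2 : nat; pose u i := (nth p0 w i).1 : nat.
have level i : (i < d + k.+1)%N -> (v i <= i)%N /\ (i <= v i + k)%N.
  move=> iw; have [|v1 v2] := minor_walk_level p0 (i := i) walk_w.
    by rewrite size_tuple.
  by rewrite size_tuple in v2; rewrite /v; lia.
pose f (s : 'I_(d + k.+1)) : 'I_(k.+1 * n) :=
  mxtens_index (inord (s - (tnth w s).2), (tnth w s).1).
have fE s : f s = ((s - v s) * n + u s)%N :> nat.
  have [v1 v2] := level s (ltn_ord s).
  by rewrite /= /v /u !(tnth_nth p0) inordK // ltnS leq_subLR.
have unindex_f s : mxtens_unindex (f s) = (inord (s - v s), (tnth w s).1).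
  by rewrite mxtens_indexK /v (tnth_nth p0).
have row_f s : ((mxtens_unindex (f s)).1 + (tnth w s).2 = s)%N.
  have [v1 v2] := level s (ltn_ord s).
  by rewrite unindex_f /= inordK ?ltnS ?leq_subLR // (tnth_nth p0) subnK.
have mono_step i : (i.+1 < d + k.+1)%N ->
    ((i - v i) * n + u i < (i.+1 - v i.+1) * n + u i.+1)%N.
  move=> iw; have [v1 _] := level i (ltnW iw); have [v2 _] := level _ iw.
  have un : (u i < n)%N by exact: ltn_ord.
  have /and4P[_ /(sortedP p0) /(_ i) stepw _ _] := walk_w.
  rewrite size_tuple in stepw; have /orP[vv|/andP[/eqP vv uu]] := stepw iw.
    rewrite -/(v _) -/(v _) in vv.
    apply: (@leq_trans ((i.+1 - v i) * n)%N); first by rewrite subSn // mulSn addnC ltn_add2r.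
    by apply: leq_trans (leq_addr _ _); rewrite leq_mul2r leq_sub2l // orbT.
  by rewrite -/(v _) -/(v _) in vv; rewrite vv subSS ltn_add2l.
have mono_f : increasing_ord f.
  move=> s t; rewrite !fE; move: (ltn_ord t).
  elim: (nat_of_ord t) => // j IHj jw; rewrite ltnS leq_eqVlt.
  case/predU1P=> [->|sj]; first exact: mono_step.
  by apply: ltn_trans (mono_step _ jw); apply: IHj => //; exact: ltnW.
have entry s : coef_mx K n d k.+1 (f s) s = 'X_(mxtens_index (tnth w s)).
  rewrite /f (coef_mxE K _ (q := (tnth w s).2)) ?leq_ord //.
    by rewrite /var_idx inord_val -surjective_pairing.
  by rewrite -[LHS]row_f unindex_f /v (tnth_nth p0).
exists (\det (rowsub f (coef_mx K n d k.+1))).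
  exists k.+1, f, w; split=> // s; split; last exact: row_f.
  by rewrite unindex_f.
have det0 : \det (rowsub f (coef_mx K n d k.+1)) != 0.
  apply: det_rowsub_neq0 => //; apply/forallP => s; rewrite perm1.
  by rewrite -{1 2}(row_f s) leq_addr leq_add2l leq_ord.
have [] := proj2 hle k.+1 _ f id kd mono_f _ det0; first by [].
move=> a lead_a; rewrite (eq_bigr _ (fun s _ => entry s)) mprodXE => /(congr1 (fun q => a \in msupp q)).
by rewrite !msuppX !inE eqxx big_tuple => /eqP <-.
Qed.

(** Otherwise let [t] be the least [u] with [a_{u,v}] in [m], or the last index if there is none.
    Then [m] satisfies the vanishing conditions that [resultant_ideal_lead] refutes. *)
Lemma resultant_ideal_edge (p : {mpoly K[n * d.+1]}) m v :
    resultant_ideal p -> is_lead_monomial le p m -> (v < d)%N -> (0 < n)%N ->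
  exists u u' : 'I_n,
    [/\ (u < u')%N, m (var_idx d u v) != 0%N & m (var_idx d u' v.+1) != 0%N].
Proof.
move=> Ip lead_m vd n0.
have [/existsP[u /existsP[u' /and3P[*]]]|no_edge] := boolP [exists u : 'I_n,
  [exists u' : 'I_n, [&& u < u', m (var_idx d u v) != 0
                               & m (var_idx d u' v.+1) != 0]]]%N.
  by exists u, u'.
suff [t lt0 gt0] : exists2 t : 'I_n,
    forall u : 'I_n, (u < t)%N -> m (var_idx d u v) = 0%N &
    forall u : 'I_n, (t < u)%N -> m (var_idx d u v.+1) = 0%N.
  by case: (resultant_ideal_lead hle vd Ip lead_m lt0 gt0).
have [/existsP[u0 mu0]|/existsPn none] :=
  boolP [exists u : 'I_n, m (var_idx d u v) != 0%N].
  case: (@arg_minnP _ u0 (fun u => m (var_idx d u v) != 0%N) val mu0) => t mt tmin.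
  exists t => u ut.
    by apply/eqP; apply: contraTT ut => /tmin; rewrite -leqNgt.
  apply/eqP; apply: contraNT no_edge => mu.
  by apply/existsP; exists t; apply/existsP; exists u; rewrite ut mt.
have nE : n.-1.+1 = n by rewrite prednK.
exists (cast_ord nE ord_max) => u /=.
  by move=> _; apply/eqP; have := none u; rewrite negbK.
by rewrite ltnNge -ltnS nE ltn_ord.
Qed.

End WalkMinors.

(** * Membership of the minors in the resultant ideal *)

(** As in a Sylvester matrix, row [(i, j)] lists the coefficients of [x^(k-1-i) f_j], with [i]
    counted from 0, from degree [d + k - 1] downwards. *)
Lemma sum_coef_mx_row (K : fieldType) (n d k : nat) (r : 'I_(k * n)) :
  \sum_(c < d + k) coef_mx K n d k r c *: 'X^(d + k - c.+1) =
  'X^(k - (mxtens_unindex r).1.+1) * generic_poly K d (mxtens_unindex r).2.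
Proof.
case: (mxtens_indexP r) => i j; rewrite mxtens_indexK /=.
have lt_col (q : 'I_d.+1) : (i + q < d + k)%N.
  by have := ltn_ord i; have := ltn_ord q; lia.
pose h q := Ordinal (lt_col q).
rewrite (bigID (fun c : 'I_(d + k) => i <= c <= i + d)%N) /= [X in _ + X]big1 ?addr0.
  rewrite (reindex_onto h (fun c => inord (c - i))) /=; last first.
    move=> c /andP[ic cid]; apply: val_inj => /=.
    by rewrite inordK ?subnKC // ltnS leq_subLR.
  rewrite mulr_sumr; apply: eq_big => [q|q _].
    by rewrite leq_addr leq_add2l leq_ord addKn inord_val eqxx.
  rewrite (coef_mxE K j (leq_ord q)) // /var_idx inord_val -scalerAr -exprD.
  congr (_ *: 'X^_) => /=.
  by have := ltn_ord i; have := ltn_ord q; lia.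
by move=> c nc; rewrite mxE mxtens_indexK /= (negPf nc) scale0r.
Qed.

(** Cramer's rule: the last row of [\adj A] combines the polynomials [x^(k-1-i) f_j] of the chosen
    rows into [\det A] times the power of [x] of the last column, which is 1. *)
Lemma det_rowsub_resultant_ideal (K : fieldType) (n d k : nat)
    (f : 'I_(d + k) -> 'I_(k * n)) : (0 < k)%N ->
  resultant_ideal (\det (rowsub f (coef_mx K n d k))).
Proof.
move=> k0; set A := rowsub f _.
have lt_last : ((d + k).-1 < d + k)%N by rewrite prednK // addn_gt0 k0 orbT.
pose l := Ordinal lt_last.
exists (d + k)%N, (fun s => (\adj A l s) *: 'X^(k - (mxtens_unindex (f s)).1.+1)),
  (fun s => generic_poly K d (mxtens_unindex (f s)).2); split.
  by move=> s; exists (mxtens_unindex (f s)).2.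
transitivity (\sum_c (\adj A *m A) l c *: 'X^(d + k - c.+1)).
  rewrite mul_adj_mx (bigD1 l) //= big1 ?addr0 => [|c lc].
    by rewrite mxE eqxx mulr1n prednK ?subnn ?expr0 ?alg_polyC // addn_gt0 k0 orbT.
  by rewrite mxE eq_sym (negPf lc) mulr0n scale0r.
under eq_bigr do rewrite mxE scaler_suml.
rewrite exchange_big; apply: eq_bigr => s _ /=.
rewrite -scalerAl -sum_coef_mx_row scaler_sumr; apply: eq_bigr => c _.
by rewrite scalerA [A s c]mxE.
Qed.

(** * Finiteness of the set of minors *)

Lemma enum_image_pred (E : eqType) (T : finType) (P : T -> Prop) (b : pred T)
    (F : T -> E) : (forall x, reflect (P x) (b x)) ->
  exists s : seq E, forall y, y \in s <-> exists2 x, P x & y = F x.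
Proof.
move=> bP; exists [seq F x | x in b] => y.
split=> [/imageP[x /bP Px ->]|[x /bP bx ->]]; first by exists x.
exact: image_f.
Qed.

(** For each [k <= d] the pairs of a row choice and a walk form a finite type once [f] is replaced
    by [finfun f]. *)
Lemma reduced_walk_minor_finite (K : fieldType) (n d : nat) :
  exists s : seq {mpoly K[n * d.+1]}, forall p, @reduced_walk_minor K n d p <-> p \in s.
Proof.
pose T k := ({ffun 'I_(d + k) -> 'I_(k * n)} *
             (d + k).-tuple ('I_n * 'I_d.+1))%type.
pose P k (x : T k) := [/\ (1 <= k <= d)%N, increasing_ord x.1,
  reduced_minor_walk x.2 & rows_of_walk x.1 x.2].
pose b k (x : T k) := [&& (1 <= k <= d)%N,
  [forall s : 'I_(d + k), [forall t : 'I_(d + k), (s < t)%N ==> (x.1 s < x.1 t)%N]],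
  minor_walk x.2 && all (fun s => ~~ minor_walk (take s x.2 ++ drop s.+1 x.2))
                        (iota 0 (size x.2)) &
  [forall s : 'I_(d + k), ((tnth x.2 s).1 == (mxtens_unindex (x.1 s)).2) &&
    ((mxtens_unindex (x.1 s)).1 + (tnth x.2 s).2 == s :> nat)%N]].
have bP k (x : T k) : reflect (P k x) (b k x).
  apply: (iffP and4P) => -[hk mono red rows]; split=> //.
  - by move=> s t; move/forallP/(_ s)/forallP/(_ t)/implyP: mono; apply.
  - case/andP: red => walk /allP red; split=> // s sw.
    by apply: red; rewrite mem_iota.
  - by move=> s; move/forallP/(_ s)/andP: rows => -[/eqP ? /eqP ?].
  - by apply/forallP => s; apply/forallP => t; apply/implyP/mono.
  - case: red => -> red; apply/allP => s; rewrite mem_iota; exact: red.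
  - by apply/forallP => s; case: (rows s) => -> ->; rewrite !eqxx.
have list k : exists s : seq {mpoly K[n * d.+1]}, forall p,
    p \in s <-> exists2 x : T k, P k x & p = \det (rowsub x.1 (coef_mx K n d k)).
  exact: enum_image_pred (bP k).
have listN c : exists s : seq {mpoly K[n * d.+1]}, forall p, p \in s <->
    exists2 k, (k < c)%N &
    exists2 x : T k, P k x & p = \det (rowsub x.1 (coef_mx K n d k)).
  elim: c => [|c [s sE]]; first by exists [::] => p; split=> // -[].
  have [t tE] := list c; exists (s ++ t) => p; rewrite mem_cat; split.
    case/orP=> [/sE[k kc hk]|/tE hc]; last by exists c.
    by exists k => //; exact: ltnW.
  case=> k; rewrite ltnS leq_eqVlt => /predU1P[->|kc] hk; apply/orP.
    by right; apply/tE.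
  by left; apply/sE; exists k.
have [s sE] := listN d.+1; exists s => p; split.
  case=> k [f [w [hk mono red rows ->]]]; apply/sE; exists k.
    by case/andP: hk.
  have fE : finfun f =1 f by exact: ffunE.
  exists (finfun f, w); last by congr (\det _); apply/matrixP => i j; rewrite !mxE fE.
  by split=> //= [s1 s2|s1]; rewrite !fE; [exact: mono | exact: rows].
case/sE=> k _ [[f w] /= [hk mono red rows] ->].
by exists k, f, w.
Qed.

(** * Comparison of the initial ideals *)

Lemma ideal_gen_sub (R : comNzRingType) (S T : R -> Prop) :
    (forall p, S p -> ideal_gen T p) ->
  forall p, ideal_gen S p -> ideal_gen T p.
Proof.
move=> ST p [m [c [g [Sg ->]]]].
have idealD x y : ideal_gen T x -> ideal_gen T y -> ideal_gen T (x + y).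
  move=> [m1 [c1 [g1 [T1 ->]]]] [m2 [c2 [g2 [T2 ->]]]].
  pose glue (h1 : 'I_m1 -> R) (h2 : 'I_m2 -> R) (i : 'I_(m1 + m2)) :=
    match split i with inl j => h1 j | inr j => h2 j end.
  exists (m1 + m2)%N, (glue c1 c2), (glue g1 g2); split.
    by move=> i; rewrite /glue; case: (split i).
  rewrite big_split_ord /=; congr (_ + _); apply: eq_bigr => i _; rewrite /glue.
    by rewrite (unsplitK (inl i)).
  by rewrite (unsplitK (inr i)).
elim/big_ind: _ => [||i _].
- by exists 0%N, (fun=> 0), (fun=> 0); split=> [[]//|]; rewrite big_ord0.
- exact: idealD.
have [m1 [c1 [g1 [T1 ->]]]] := ST _ (Sg i).
exists m1, (fun j => c i * c1 j), g1; split=> //.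
by rewrite mulr_sumr; apply: eq_bigr => j _; rewrite mulrA.
Qed.

Lemma ideal_gen_mul (R : comNzRingType) (S : R -> Prop) c g :
  S g -> ideal_gen S (c * g).
Proof. by move=> Sg; exists 1%N, (fun=> c), (fun=> g); split; rewrite ?big_ord1. Qed.

Theorem mainTheorem2 (n d : nat) (K : closedFieldType)
    (le : rel 'X_{1..n * d.+1}) (hn : (1 < n)%N) (hd : (1 < d)%N)
    (hle : diagonal_term_order K le) :
  groebner_basis le (@resultant_ideal K n d) (@reduced_walk_minor K n d).
Proof.
have sub_ideal p : @reduced_walk_minor K n d p -> resultant_ideal p.
  case=> k [f [w [/andP[k0 _] _ _ _ ->]]]; exact: det_rowsub_resultant_ideal.
split=> //; first exact: reduced_walk_minor_finite.
move=> p; split; apply: ideal_gen_sub => {p} _ [p [m [Ip lead_p ->]]]; last first.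
  rewrite -['X_[m]]mul1r; apply: ideal_gen_mul; exists p, m; split=> //.
  exact: sub_ideal.
have [|v vd|w [walk_w uniq_w size_w w_m]] :=
    @walk_of_edges n d (fun x => m (mxtens_index x) != 0%N).
- exact: ltnW.
- by apply: (resultant_ideal_edge hle Ip lead_p vd); exact: ltnW.
have [r sub_r red_r] := reduced_subwalk walk_w.
have size_r : (d < size r)%N by case: red_r => /and4P[].
(* The minor is taken in [M_{k+1}]; the required [k < d] follows from [size w <= d + d]. *)
pose k := (size r - d.+1)%N.
have rE : size r == (d + k.+1)%N by apply/eqP; rewrite /k; lia.
have kd : (k < d)%N.
  rewrite /k ltn_subLR // addSn ltnS.
  exact: leq_trans (size_subseq sub_r) size_w.
have [g Gg lead_g] := walk_minor_lead hle (w := Tuple rE) kd red_r.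
set a := (\sum_(x <- _) _)%MM in lead_g.
(* The points of [r] are distinct, so [a] is squarefree and divides [m] as soon as [m] involves each
   of its variables. *)
have am : (a <= m)%MM.
  apply/mnm_lepP => x; rewrite mnm_sumE /=.
  rewrite -[x]mxtens_unindexK; set y := mxtens_unindex x.
  have uniq_r : uniq r := subseq_uniq sub_r uniq_w.
  have [yr|yr] := boolP (y \in r).
    rewrite (bigD1_seq y) //= mnm1E eqxx big1 => [|z zy].
      by rewrite addn0 lt0n; exact: (allP w_m _ (mem_subseq sub_r yr)).
    by rewrite mnm1E (can_eq (@mxtens_indexK _ _)) (negPf zy).
  rewrite big_seq big1 // => z zr; rewrite mnm1E (can_eq (@mxtens_indexK _ _)).
  by case: eqP => // zy; rewrite -zy zr in yr.
rewrite -(submK am) mpolyXD; apply: ideal_gen_mul.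
by exists g, a.
Qed.
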